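(* Let $(X,\tau)$ be a Hausdorff topological vector space over $\mathbb{R}$ which is quasi-point-separable. Then $X$ has the fixed point property: for every nonempty, compact, convex subset $C\subseteq X$ and every $\tau$-continuous mapping $f:C\to C$, there exists $x_0\in C$ with $f(x_0)=x_0$.
   Context: All vector spaces are real; $\theta$ denotes the origin of $X$ and $\mathbb{R}^+=[0,\infty)$. A function $u:X\to\mathbb{R}^+$ is called m-quasiconvex if $u(\theta)=0$ and for all $x_1,x_2\in X$ and $0\le\alpha\le1$ one has $u(\alpha x_1+(1-\alpha)x_2)\le\max\{u(x_1),u(x_2)\}$. A topological vector space $(X,\tau)$ is called quasi-point-separable if there is a family $\{u_\lambda\}_{\lambda\in\Lambda}$ of $\tau$-continuous m-quasiconvex functions on $X$ such that, for $x\in X$, $u_\lambda(x)=0$ for every $\lambda\in\Lambda$ implies $x=\theta$; such a family is called a quasi-point-separating space for $X$. *)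

(* Defs.v *)
From HB Require Import structures.
From mathcomp Require Import all_boot all_order all_algebra.
From mathcomp Require Import all_classical all_reals all_analysis.
Set Implicit Arguments. Unset Strict Implicit. Unset Printing Implicit Defensive.
Import Order.TTheory GRing.Theory Num.Theory.
Import numFieldNormedType.Exports.
Local Open Scope classical_set_scope.
Local Open Scope ring_scope.

Definition m_quasiconvex (R : realType) (X : lmodType R) (u : X -> R) : Prop :=
  (forall x, 0 <= u x) /\ u 0 = 0 /\
  forall (x1 x2 : X) (a : R), 0 <= a -> a <= 1 ->
    u (a *: x1 + (1 - a) *: x2) <= Num.max (u x1) (u x2).

Definition quasi_point_separable (R : realType) (X : topologicalLmodType R) : Prop :=
  exists (L : Type) (u : L -> X -> R),
    (forall l, continuous (u l)) /\
    (forall l, m_quasiconvex (u l)) /\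
    (forall x : X, (forall l, u l x = 0) -> x = 0).

Definition fixed_point_property (R : realType) (X : topologicalLmodType R) : Prop :=
  forall (C : set X), C !=set0 -> compact C -> convex_set (C : set (convex_lmodType X)) ->
  forall f : X -> X, {within C, continuous f} -> f @` C `<=` C ->
  exists2 x0, C x0 & f x0 = x0.

(* Main.v *)
Require Import Defs.
From HB Require Import structures.
From mathcomp Require Import all_boot all_order zify.

(** If [u] is continuous and m-quasiconvex, then [u (f x - x) = 0] for some [x] in
    [C]. The maximum of finitely many functions of the separating family is again
    continuous and m-quasiconvex, so the closed sets [{x | u (f x - x) = 0}], for [u]
    in the family, have the finite intersection property in [C]; a common point is
    fixed by [f].

    Since [C] is compact, it suffices to make [u (f x - x) <= eps]. Cover [C] by
    finitely many sets [{z | u (z - y i) < eps}] with [y i] in [C], and write [g t]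
    for the sum of the [t i *: y i], where [t] ranges over the standard simplex. The
    closed sets [{t | u (f (g t) - y i) <= eps}] cover the simplex, so some [t] lies
    in the [i]-th of them whenever [t i > 0]; as [f (g t) - g t] is then a convex
    combination of the corresponding [f (g t) - y i], quasiconvexity gives
    [u (f (g t) - g t) <= eps].

    Such a point [t] is a cluster point of ever smaller cells of grid points that
    carry all the labels of their (approximate) support. These cells come from
    Scarf's combinatorial lemma, a parity argument that replaces Sperner's lemma
    and needs no triangulation. *)

Import Order.TTheory.

Set Implicit Arguments. Unset Strict Implicit. Unset Printing Implicit Defensive.

(** * Counting lemmas for finite sets *)

Section FinsetCounting.
Variables (aT rT : finType).
Implicit Types (A B : {set aT}) (f : aT -> rT).

Lemma imsetD1_eq f A x y :
  y \in A -> y != x -> f y = f x -> f @: (A :\ x) = f @: A.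
Proof.
move=> yA yx fyx; apply/eqP; rewrite eqEsubset imsetS ?subsetDl //=.
apply/subsetP => _ /imsetP[w wA ->].
have [->|wx] := eqVneq w x; first by rewrite -fyx imset_f // !inE yx.
by rewrite imset_f // !inE wx.
Qed.

Lemma card_imsetD1_eq f A : #|A| = #|f @: A|.+1 ->
  #|[set x in A | f @: (A :\ x) == f @: A]| = 2.
Proof.
move=> cardA.
have /dinjectivePn[x xA [y /andP[yx yA] fxy]] : ~~ dinjectiveb f A.
  by apply/dinjectiveP => /imset_injP; rewrite cardA eqn_leq ltnn andbF.
have f_surj := imsetD1_eq yA yx (esym fxy).
have f_inj : {in A :\ x &, injective f}.
  by apply/imset_injP; rewrite f_surj -eqSS -cardA (cardsD1 x A) xA.
rewrite (_ : [set _ in A | _] = [set x; y]) ?cards2 1?eq_sym ?yx //.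
apply/setP => z; rewrite !inE; apply/andP/orP => [[zA /eqP fz]|].
  have [->|zx] := eqVneq z x; [by left|right].
  have /imsetP[w] : f z \in f @: (A :\ z) by rewrite fz imset_f.
  rewrite !inE => /andP[wz wA] fzw; have [wx|wx] := eqVneq w x.
    by apply/eqP/f_inj; rewrite ?inE ?zx ?yx // fzw wx.
  by case/eqP: wz; apply: f_inj; rewrite // !inE ?wx ?zx.
case=> /eqP->; first by rewrite f_surj.
by rewrite (imsetD1_eq xA) // eq_sym.
Qed.

Lemma even_card_imsetD1_setC1 f A b : #|A| = #|rT| -> f @: A != setT ->
  ~~ odd #|[set x in A | f @: (A :\ x) == [set~ b]]|.
Proof.
move=> cardA fA; have [->|[x]] := set_0Vmem [set x in A | f @: (A :\ x) == [set~ b]].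
  by rewrite cards0.
rewrite inE => /andP[xA /eqP fx].
have fAE : f @: A = [set~ b].
  apply/eqP; rewrite eqEsubset -{2}fx imsetS ?subsetDl // andbT.
  apply/subsetP => _ /imsetP[w wA ->]; rewrite !inE.
  apply: contra fA => /eqP fw; rewrite eqEsubset subsetT /=.
  apply/subsetP => b' _; have [->|b'b] := eqVneq b' b; first by rewrite -fw imset_f.
  have : b' \in [set~ b] by rewrite !inE.
  by rewrite -fx; apply/subsetP/imsetS; rewrite subsetDl.
rewrite -fAE card_imsetD1_eq // cardA fAE cardsC1 prednK //.
by apply/card_gt0P; exists b.
Qed.

Lemma card_facets A (P : pred {set aT}) :
  #|[set B : {set aT} | [&& #|B|.+1 == #|A|, B \subset A & P B]]| =
  #|[set x in A | P (A :\ x)]|.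
Proof.
rewrite -[RHS](card_in_imset (f := fun x => A :\ x)); last first.
  move=> x y; rewrite !inE => /andP[xA _] _ /setP/(_ x).
  by rewrite !inE eqxx xA andbT /=; case: eqP.
apply: eq_card => B; rewrite inE; apply/and3P/imsetP => [[/eqP cB BA PB]|[x]].
  have /cards1P[x Bx] : #|A :\: B| == 1.
    by rewrite cardsD (setIidPr BA) -cB; apply/eqP; lia.
  have BE : B = A :\ x by rewrite -Bx setDDr setDv set0U; apply/esym/setIidPr.
  have xA : x \in A by have := set11 x; rewrite -Bx inE => /andP[].
  by exists x => //; rewrite inE xA -BE.
by rewrite inE => /andP[xA PB] ->; rewrite subsetDl (cardsD1 x A) xA.
Qed.

Lemma card_cofacets A (P : pred {set aT}) :
  #|[set B : {set aT} | [&& #|B| == #|A|.+1, A \subset B & P B]]| =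
  #|[set x | (x \notin A) && P (x |: A)]|.
Proof.
rewrite -[RHS](card_in_imset (f := fun x => x |: A)); last first.
  move=> x y; rewrite !inE => /andP[xA _] _ /setP/(_ x).
  by rewrite !inE eqxx (negbTE xA) orbF; case: eqP.
apply: eq_card => B; rewrite inE; apply/and3P/imsetP => [[/eqP cB AB PB]|[x]].
  have /cards1P[x Bx] : #|B :\: A| == 1.
    by rewrite cardsD (setIidPr AB) cB; apply/eqP; lia.
  have BE : B = x |: A by rewrite -Bx setUC -{1}(setIidPr AB) setID.
  have xA : x \notin A by have := set11 x; rewrite -Bx inE => /andP[].
  by exists x => //; rewrite inE xA -BE.
by rewrite inE => /andP[xA PB] ->; rewrite subsetUr cardsU1 xA.
Qed.

Lemma sum_card_incident (A : {set aT}) (B : {set rT}) (e : aT -> rT -> bool) :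
  \sum_(x in A) #|[set y in B | e x y]| = \sum_(y in B) #|[set x in A | e x y]|.
Proof.
under eq_bigr do rewrite -sum1dep_card.
under [RHS]eq_bigr do rewrite -sum1dep_card.
rewrite (exchange_big_dep (mem B)) /= => [|x y _ /andP[]//].
by apply: eq_bigr => y yB; apply: eq_bigl => x; rewrite yB.
Qed.
End FinsetCounting.

Lemma odd_sum (I : Type) (s : seq I) (P : pred I) (F : I -> nat) :
  odd (\sum_(i <- s | P i) F i) = \big[addb/false]_(i <- s | P i) odd (F i).
Proof. exact: (big_morph odd oddD). Qed.

(** * Scarf's lemma *)

Section Scarf.
Variables (d : Order.disp_t) (K : orderType d) (I T : finType) (r : I -> T -> K).
Hypothesis r_inj : forall i, injective (r i).
Implicit Types (Q : {set T + I}) (i k l : I) (x y : T) (z w : T + I).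

(* A point [inr i], the slack point of the order [i], lies below all of [T] in the
   order [i] and above all of [T] in the others. Thus [inr i \in Q] says that the
   order [i] plays no role in deciding whether [Q] is dominant. *)
Definition below i z y : bool :=
  match z with inl x => (r i x < r i y)%O | inr j => j == i end.

Definition above Q : {set T} := [set y | [forall i, exists z in Q, below i z y]].

Definition dominant Q : bool := above Q == set0.

Definition least i Q z : bool :=
  match z with inl x => [forall w in Q, ~~ below i w x] | inr j => j == i end.

Lemma below_le i z x y : below i z y -> (r i y <= r i x)%O -> below i z x.
Proof. by case: z => //= w wy yx; apply: lt_le_trans yx. Qed.

Lemma aboveP Q y :
  reflect (forall i, exists2 z, z \in Q & below i z y) (y \in above Q).
Proof.
by rewrite inE; apply: (iffP forallP) => below_y i; apply/exists_inP; apply: below_y.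
Qed.

Lemma above_slackP Q k y :
  reflect (forall i, i != k -> exists2 z, z \in Q & below i z y)
          (y \in above (inr k |: Q)).
Proof.
apply: (iffP (aboveP _ _)) => [below_y i ik|below_y i].
  by have [z /setU1P[->/=|]] := below_y i; [rewrite eq_sym (negbTE ik)|exists z].
have [->|/below_y[z zQ zy]] := eqVneq i k; first by exists (inr k); rewrite ?setU11 /=.
by exists z; rewrite // setU1r.
Qed.

Lemma aboveS Q1 Q2 : Q1 \subset Q2 -> above Q1 \subset above Q2.
Proof.
move=> /subsetP Q12; apply/subsetP => y /aboveP below_y; apply/aboveP => i.
by have [z /Q12] := below_y i; exists z.
Qed.

Lemma dominantS Q1 Q2 : Q1 \subset Q2 -> dominant Q2 -> dominant Q1.
Proof. by move=> /aboveS Q12 /eqP dom2; rewrite /dominant -subset0 -dom2. Qed.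

Lemma dominantP Q :
  reflect (forall y, exists i, forall z, z \in Q -> ~~ below i z y) (dominant Q).
Proof.
apply: (iffP eqP) => [Q0 y|dom].
  have : y \notin above Q by rewrite Q0 inE.
  rewrite inE negb_forall => /existsP[i]; rewrite negb_exists_in.
  by move/forall_inP; exists i.
apply/setP => y; rewrite [RHS]inE; apply/negP => /aboveP below_y.
by have [i zi] := dom y; have [z /zi/negP] := below_y i.
Qed.

Lemma leastS i Q1 Q2 z : Q1 \subset Q2 -> least i Q2 z -> least i Q1 z.
Proof.
case: z => //= x /subsetP Q12 /forall_inP x_least.
by apply/forall_inP => w /Q12; apply: x_least.
Qed.

Lemma least_uniq i Q z w :
  z \in Q -> w \in Q -> least i Q z -> least i Q w -> z = w.
Proof.
case: z w => [x|j] [y|k] /= zQ wQ.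
- move=> /forall_inP/(_ _ wQ) yx /forall_inP/(_ _ zQ) /= xy.
  by rewrite (@r_inj i x y) //; apply/eqP; rewrite eq_le !leNgt xy yx.
- by move=> /forall_inP/(_ _ wQ)/negP.
- by move=> ji /forall_inP/(_ _ zQ)/negP.
- by move=> /eqP-> /eqP->.
Qed.

Lemma dominant_least Q z : dominant Q -> exists i, least i Q z.
Proof.
case: z => [x|j] dom; last by exists j => /=.
by have /dominantP/(_ x)[i xi] := dom; exists i; apply/forall_inP.
Qed.

Lemma exists_least i Q x : inl x \in Q -> exists2 z, z \in Q & least i Q z.
Proof.
move=> xQ; have [iQ|iQ] := boolP (inr i \in Q); first by exists (inr i) => /=.
have [y yQ ymin] := arg_minP (r i) (xQ : [pred y | inl y \in Q] x).
exists (inl y) => //; apply/forall_inP => -[w|j] /= wQ; first by rewrite -leNgt ymin.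
by apply: contraNneq iQ => <-.
Qed.

Lemma least_index_uniq i j Q z : dominant Q -> #|Q| = #|I| -> z \in Q ->
  least i Q z -> least j Q z -> i = j.
Proof.
move=> dom cardQ zQ zi zj.
have [f fP] := fin_all_exists (fun w => dominant_least w dom).
have f_inj : {in Q &, injective f}.
  by move=> w1 w2 w1Q w2Q fw; apply: least_uniq (fP w1) _; rewrite // fw.
have fQ : f @: Q = setT.
  by apply/eqP; rewrite eqEcard subsetT (card_in_imset f_inj) cardQ cardsT /=.
suff fz k : least k Q z -> k = f z by rewrite (fz i zi) (fz j zj).
have /imsetP[w wQ ->] : k \in f @: Q by rewrite fQ inE.
by move=> /(least_uniq wQ zQ (fP w)) ->.
Qed.

Definition redundant Q : {set I} :=
  [set k | [forall z in Q, exists i, (i != k) && least i Q z]].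

Lemma redundantP Q k :
  reflect (forall z, z \in Q -> exists2 i, i != k & least i Q z) (k \in redundant Q).
Proof.
rewrite inE; apply: (iffP forall_inP) => red z /red.
  by case/existsP => i /andP[]; exists i.
by case=> i ik zi; apply/existsP; exists i; rewrite ik.
Qed.

Lemma card_redundant_slack Q : (forall x, inl x \notin Q) -> #|Q|.+1 = #|I| ->
  #|redundant Q| = 1.
Proof.
move=> noT cardQ.
have redE : redundant Q = [set k | inr k \notin Q].
  apply/setP => k; rewrite [RHS]inE; apply/redundantP/idP => [red|kQ [x|j]].
  - by apply/negP => /red[i ik /= /eqP ki]; rewrite ki eqxx in ik.
  - by rewrite (negbTE (noT x)).
  - by move=> jQ; exists j => //=; apply: contraNneq kQ => <-.
have QE : Q = inr @: ~: redundant Q.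
  rewrite redE; apply/setP => -[x|j]; last first.
    by rewrite mem_imset ?inE ?negbK // => ? ? [].
  by rewrite (negbTE (noT x)); apply/esym/imsetP => -[].
have card_slack : #|Q| = #|~: redundant Q|.
  by rewrite [in LHS]QE card_imset // => ? ? [].
by have := cardsC (redundant Q); rewrite -cardQ card_slack; lia.
Qed.

Lemma card_redundant_point Q x : inl x \in Q -> dominant Q -> #|Q|.+1 = #|I| ->
  #|redundant Q| = 2.
Proof.
move=> xQ dom cardQ.
have [f fQ f_least] := fin_all_exists2 (fun i => exists_least i xQ).
have fE z i : z \in Q -> least i Q z -> f i = z.
  by move=> zQ; apply: least_uniq.
have imfQ : f @: setT = Q.
  apply/setP => z; apply/imsetP/idP => [[i _ ->]//|zQ].
  by have [i zi] := dominant_least z dom; exists i; rewrite // (fE z).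
rewrite -(@card_imsetD1_eq _ _ f setT); last by rewrite imfQ cardsT.
apply: eq_card => k; rewrite [RHS]inE in_setT imfQ eqEsubset /=.
have -> /= : f @: (setT :\ k) \subset Q by apply/subsetP => _ /imsetP[i _ ->].
apply/redundantP/subsetP => covered z zQ.
  by have [i ik zi] := covered z zQ; apply/imsetP; exists i; rewrite ?inE ?ik // (fE z).
by have /imsetP[i] := covered z zQ; rewrite !inE andbT => ik ->; exists i.
Qed.

Variant pivot_spec Q k : T + I -> Prop :=
  | PivotPoint x of x \in above (inr k |: Q)
      & (forall y, y \in above (inr k |: Q) -> (r k y <= r k x)%O) :
      pivot_spec Q k (inl x)
  | PivotSlack of dominant (inr k |: Q) : pivot_spec Q k (inr k).

(* Scarf's replacement step: adding the slack point of [k] to [Q] gives a dominant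
   set unless points of [T] then lie above it; in that case one adds the highest of
   these points in the order [k]. *)
Definition pivot Q k : T + I :=
  let A := above (inr k |: Q) in
  if [pick x in A | [forall y in A, r k y <= r k x]%O] is Some x
  then inl x else inr k.

Lemma pivotP Q k : pivot_spec Q k (pivot Q k).
Proof.
rewrite /pivot; case: pickP => [x /andP[xA /forall_inP]|noA]; first exact: PivotPoint.
apply: PivotSlack; apply/set0Pn => -[x0 x0A].
have [x xA xmax] := arg_maxP (r k) x0A; move/negP: (noA x); apply.
by apply/andP; split; last exact/forall_inP.
Qed.

Lemma pivot_uniq Q k z : pivot_spec Q k z -> pivot Q k = z.
Proof.
case: pivotP => [x xA xmax|dom] [y yA ymax|dom'] //.
- by rewrite (@r_inj k x y) //; apply/eqP; rewrite eq_le ymax ?xmax.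
- by move: xA; rewrite (eqP dom') inE.
- by move: yA; rewrite (eqP dom) inE.
Qed.

Lemma least_redundant Q k z : z \notin Q -> dominant (z |: Q) ->
  least k (z |: Q) z -> k \in redundant Q.
Proof.
move=> zQ dom zk; apply/redundantP => w wQ.
have [i wi] := dominant_least w dom; exists i; last exact: leastS (subsetUr _ _) wi.
apply: contraNneq zQ => ik; rewrite (_ : z = w) //.
by apply: least_uniq zk _; rewrite ?setU11 ?setU1r // -ik.
Qed.

Lemma pivot_completion Q k : dominant Q -> k \in redundant Q ->
  (pivot Q k \notin Q) && dominant (pivot Q k |: Q).
Proof.
move=> /eqP dom /redundantP red; case: pivotP => [x /above_slackP xA xmax|->].
  have xQ : inl x \notin Q.
    apply/negP => /red[i ik /forall_inP xi]; have [z /xi] := xA i ik.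
    by move/negP.
  rewrite xQ; apply/eqP/setP => y; rewrite [RHS]inE; apply/negP => /aboveP yx.
  have yk : (r k y <= r k x)%O.
    apply/xmax/above_slackP => i ik; have [z /setU1P[->/ltW xy|]] := yx i.
      by have [w wQ wx] := xA i ik; exists w => //; apply: below_le xy.
    by exists z.
  have [z /setU1P[->|zQ zy]] := yx k; first by rewrite /= ltNge yk.
  have : x \in above Q; last by rewrite dom inE.
  apply/aboveP => i; have [->|/xA//] := eqVneq i k.
  by exists z => //; apply: below_le yk.
rewrite andbT; apply/negP => /red[i ik /= /eqP ki].
by rewrite ki eqxx in ik.
Qed.

Lemma completion_is_pivot Q z : dominant Q -> #|Q|.+1 = #|I| -> z \notin Q ->
  dominant (z |: Q) -> exists2 k, k \in redundant Q & z = pivot Q k.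
Proof.
move=> domQ cardQ zQ domzQ; have [k zk] := dominant_least z domzQ.
exists k; first exact: least_redundant zk.
apply/esym/pivot_uniq; case: z zQ domzQ zk => [x|j] zQ domzQ zk; last first.
  by rewrite -(eqP zk); apply: PivotSlack.
apply: PivotPoint => [|y /above_slackP yA].
  apply/above_slackP => i ik; apply/exists_inP; apply: contraNT ik.
  move=> /exists_inPn xi; apply/eqP.
  apply: (least_index_uniq domzQ) (zk); rewrite ?setU11 ?cardsU1 ?zQ //.
  apply/forall_inP => w /setU1P[->|wQ] /=; first by rewrite ltxx.
  exact: xi.
have /dominantP/(_ y)[i yi] := domzQ.
have [ik|/yA[w wQ wy]] := eqVneq i k.
  by have := yi (inl x) (setU11 _ _); rewrite ik /= -leNgt.
by case/negP: (yi w (setU1r _ wQ)).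
Qed.

Lemma pivot_inj Q : dominant Q -> injective (pivot Q).
Proof.
move=> /eqP dom k l; case: pivotP => [x /above_slackP xk _|domk]; last first.
  by case: pivotP => // _ [].
case: pivotP => [y /above_slackP yl _ [xy]|//]; subst y.
apply: contra_eq dom => kl; apply/set0Pn; exists x; apply/aboveP => i.
by have [->|/xk//] := eqVneq i k; apply: yl.
Qed.

Lemma door_completions Q : dominant Q -> #|Q|.+1 = #|I| ->
  [set z | (z \notin Q) && dominant (z |: Q)] = pivot Q @: redundant Q.
Proof.
move=> dom cardQ; apply/setP => z; rewrite inE; apply/andP/imsetP.
  by case; apply: completion_is_pivot.
by case=> k /(pivot_completion dom)/andP[pQ dp] ->.
Qed.

Lemma odd_door_completions Q : dominant Q -> #|Q|.+1 = #|I| ->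
  odd #|[set z | (z \notin Q) && dominant (z |: Q)]| = [forall x, inl x \notin Q].
Proof.
move=> dom cardQ; rewrite door_completions // card_imset; last exact: pivot_inj.
have [/forallP noT|/forallPn[x /negPn xQ]] := boolP [forall x, inl x \notin Q].
  by rewrite card_redundant_slack.
by rewrite (@card_redundant_point Q x).
Qed.

Variable c : T -> I.

Definition colour z : I := match z with inl x => c x | inr i => i end.

Section Doors.
Variable i0 : I.

Definition rooms : {set {set T + I}} :=
  [set Q : {set T + I} | (#|Q| == #|I|) && dominant Q].

Definition doors : {set {set T + I}} :=
  [set Q : {set T + I} | [&& #|Q|.+1 == #|I|, dominant Q & colour @: Q == [set~ i0]]].

Definition outer_door : {set T + I} := inr @: [set~ i0].

Lemma outer_door_is_door : outer_door \in doors.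
Proof.
rewrite inE card_imset ?cardsC1; last by move=> ? ? [].
rewrite prednK ?eqxx /=; last by apply/card_gt0P; exists i0.
apply/andP; split.
  by apply/dominantP => y; exists i0 => _ /imsetP[i ii0 ->]; rewrite !inE in ii0.
by rewrite -imset_comp; apply/eqP; exact: imset_id.
Qed.

Lemma door_slack Q :
  Q \in doors -> [forall x, inl x \notin Q] = (Q == outer_door).
Proof.
move=> Qdoor; apply/forallP/eqP => [noT|-> x]; last by apply/imsetP => -[].
move: Qdoor; rewrite inE => /and3P[/eqP cardQ _ /eqP colQ].
apply/eqP; rewrite eqEcard -ltnS cardQ.
move: outer_door_is_door; rewrite inE => /andP[/eqP-> _]; rewrite leqnn andbT.
apply/subsetP => -[x|i]; first by rewrite (negbTE (noT x)).
by move/(imset_f colour); rewrite colQ; apply: imset_f.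
Qed.

Lemma odd_rooms_over_door D :
  D \in doors -> odd #|[set Q in rooms | D \subset Q]| = (D == outer_door).
Proof.
move=> Ddoor; rewrite -door_slack //.
move: Ddoor; rewrite inE => /and3P[/eqP cardD domD _].
rewrite -odd_door_completions // -card_cofacets cardD; congr odd.
by apply: eq_card => Q; rewrite !inE andbAC andbA.
Qed.

Lemma even_doors_under_room Q : Q \in rooms -> colour @: Q != setT ->
  ~~ odd #|[set D in doors | D \subset Q]|.
Proof.
rewrite inE => /andP[/eqP cardQ domQ] colQ.
rewrite (_ : #|_| = #|[set z in Q | colour @: (Q :\ z) == [set~ i0]]|).
  exact: even_card_imsetD1_setC1.
rewrite -(card_facets Q (fun D => colour @: D == [set~ i0])); apply: eq_card => D.
rewrite !inE cardQ; have [DQ|] := boolP (D \subset Q); last by rewrite !andbF.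
by rewrite (dominantS DQ domQ) !andbT.
Qed.
End Doors.

Theorem scarf (i0 : I) : exists2 Q, dominant Q & colour @: Q = setT.
Proof.
have [/exists_inP[Q]|/exists_inPn noQ] :=
    boolP [exists Q in rooms, colour @: Q == setT].
  by rewrite inE => /andP[_ domQ] /eqP; exists Q.
have : odd (\sum_(D in doors i0) #|[set Q in rooms | D \subset Q]|).
  rewrite odd_sum (bigD1 (outer_door i0)) ?outer_door_is_door //=.
  rewrite (odd_rooms_over_door (outer_door_is_door i0)) eqxx big1 // => D /andP[Ddoor Do].
  by rewrite (odd_rooms_over_door Ddoor) (negbTE Do).
rewrite -sum_card_incident odd_sum big1 // => Q Qroom.
by apply/negbTE/even_doors_under_room/noQ.
Qed.
End Scarf.

(** * Small cells in the grid of the simplex *)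

Section Grid.
Variables (I : finType) (N : nat).
Implicit Types (i k : I) (m : I -> nat).

Definition grid := {a : {ffun I -> 'I_N.+1} | \sum_k a k == N :> nat}.
Implicit Types a b : grid.

Definition grid_coord a i : nat := val a i.

Definition grid_rank i a : nat *l 'I_#|{: grid}| := (grid_coord a i, enum_rank a).

Lemma grid_rank_inj i : injective (grid_rank i).
Proof. by move=> a b [_ /enum_rank_inj]. Qed.

Lemma grid_rank_le i a b :
  (grid_rank i a <= grid_rank i b)%O -> grid_coord a i <= grid_coord b i.
Proof. by rewrite lexi_pair => /andP[]. Qed.

Lemma sum_grid_coord a : \sum_i grid_coord a i = N.
Proof. exact/eqP/(valP a). Qed.

Lemma grid_coord_le a m k : (forall i, m i <= grid_coord a i) ->
  grid_coord a k + \sum_i m i <= m k + N.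
Proof.
move=> ma; rewrite -(sum_grid_coord a) (bigD1 k) //= [in leqRHS](bigD1 k) //=.
by rewrite addnCA leq_add2l leq_add2l leq_sum.
Qed.

Lemma exists_grid_ge (i0 : I) m :
  \sum_i m i <= N -> exists a, forall i, m i <= grid_coord a i.
Proof.
move=> mN; pose b k := m k + (k == i0) * (N - \sum_i m i).
have sumb : \sum_k b k = N.
  rewrite big_split /= [X in _ + X](bigD1 i0) //= eqxx mul1n.
  by rewrite [X in _ + (_ + X)]big1 ?addn0 ?subnKC // => k /negbTE->.
have bN k : b k < N.+1 by rewrite ltnS -[leqRHS]sumb (bigD1 k) //= leq_addr.
pose a := [ffun k => Ordinal (bN k)].
have aP : \sum_k a k == N :> nat.
  by rewrite -[X in _ == X]sumb; apply/eqP/eq_bigr => k _; rewrite ffunE.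
by exists (exist _ a aP) => i; rewrite /grid_coord /= ffunE /= leq_addr.
Qed.

Lemma dominant_grid_point (Q : {set grid + I}) a : dominant grid_rank Q ->
  exists2 i, inr i \notin Q &
    forall b, inl b \in Q -> grid_coord a i <= grid_coord b i.
Proof.
move=> /dominantP/(_ a)[i ai]; exists i => [|b /ai].
  by apply/negP => /ai/=; rewrite eqxx.
by rewrite /= -leNgt; apply: grid_rank_le.
Qed.

(* If the sum were smaller, some grid point would exceed the minima of all the
   orders that are not disregarded, contradicting dominance. *)
Lemma dominant_grid_minima (i0 : I) (Q : {set grid + I}) : dominant grid_rank Q ->
  exists m, [/\ forall a, inl a \in Q -> forall i, m i <= grid_coord a i,
    forall i, inr i \in Q -> m i = 0 & N < \sum_i m i + #|I|].
Proof.
move=> domQ.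
pose m i := if inr i \in Q then 0
  else \big[Order.min/N]_(a | inl a \in Q) grid_coord a i.
exists m; split=> [a aQ i|i iQ|]; last 1 first.
- rewrite ltnNge; apply/negP => mN.
  have [|a am] := @exists_grid_ge i0 (fun i => (m i).+1).
    by under eq_bigr do rewrite -addn1; rewrite big_split /= sum1_card.
  have [i iQ ai] := dominant_grid_point a domQ.
  have : grid_coord a i <= m i; last by rewrite leqNgt am.
  rewrite /m (negbTE iQ) -leEnat; apply: le_bigmin => [|b]; last exact: ai.
  exact: leq_ord.
- by rewrite /m; case: ifP => // _; rewrite -leEnat; exact: bigmin_le_cond.
- by rewrite /m iQ.
Qed.

Lemma small_cell (i0 : I) (lab : grid -> I) :
  exists (C : {set I}) (p : I -> grid), [/\ C != set0,
    forall i, i \in C -> lab (p i) = i,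
    forall i j k, i \in C -> j \in C ->
      grid_coord (p i) k <= grid_coord (p j) k + #|I| &
    forall i k, i \in C -> k \notin C -> grid_coord (p i) k <= #|I|].
Proof.
have [a0 _] : exists a, forall i, 0 <= grid_coord a i.
  by apply: (exists_grid_ge i0 (m := fun=> 0)); rewrite big1.
have [Q domQ colQ] := scarf grid_rank_inj lab i0.
have [m [mQ m0 mN]] := dominant_grid_minima i0 domQ.
pose C := [set i | inr i \notin Q].
have pick_label i : exists a, i \in C -> inl a \in Q /\ lab a = i.
  have /imsetP[[a|j] zQ ->] : i \in colour lab @: Q by rewrite colQ.
    by exists a.
  by exists a0; rewrite inE zQ.
have [p pP] := fin_all_exists pick_label.
have pm i : i \in C -> forall k, m k <= grid_coord (p i) k by move=> /pP[/mQ].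
have p_le i k : i \in C -> grid_coord (p i) k <= m k + #|I|.
  by move=> /pm /(grid_coord_le k); lia.
exists C, p; split=> [|i /pP[]//|i j k iC jC|i k iC].
- have [i iQ _] := dominant_grid_point a0 domQ.
  by apply/set0Pn; exists i; rewrite inE.
- by apply: leq_trans (p_le i k iC) _; rewrite leq_add2r pm.
- by rewrite inE negbK => /m0 mk; have := p_le i k iC; rewrite mk.
Qed.
End Grid.

(* Not imported earlier: the classical sets reuse the names of the [finset] lemmas. *)
From mathcomp Require Import all_algebra finmap.
From mathcomp Require Import all_classical all_reals all_analysis.
From mathcomp Require Import ring lra.
Import GRing.Theory Num.Theory.
Import numFieldNormedType.Exports.
Local Open Scope classical_set_scope.
Local Open Scope ring_scope.

(** * Closed covers of the simplex *)

Section Simplex.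
Variables (R : realType) (n : nat).
Implicit Types (t : 'rV[R]_n) (i : 'I_n).

Definition simplex : set 'rV[R]_n :=
  [set t | (forall i, 0 <= t ord0 i) /\ \sum_i t ord0 i = 1].

Lemma simplex_le1 t i : simplex t -> t ord0 i <= 1.
Proof.
move=> [t0 <-]; rewrite (bigD1 i) //= lerDl; apply: sumr_ge0 => k _; exact: t0.
Qed.

Lemma closed_simplex : closed simplex.
Proof.
have -> : simplex = (\bigcap_i [set t | 0 <= t ord0 i]) `&`
    [set t | \sum_i t ord0 i = 1].
  apply/seteqP; split => [t [t0 t1]|t [t0 t1]]; split => // i; last exact: t0.
  by move=> _; exact: t0.
apply: closedI.
  apply: closed_bigI => i _.
  apply: (@preimage_closed _ _ (fun t => t ord0 i) [set x | 0 <= x]).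
    by move=> t _; exact: coord_continuous.
  exact: closed_ge.
apply: (@preimage_closed _ _ (fun t => \sum_i t ord0 i) [set 1]).
  move=> t _; move: t; apply: continuous_big => [|i _]; first exact: add_continuous.
  exact: coord_continuous.
exact: closed_eq.
Qed.

Lemma compact_simplex : compact simplex.
Proof.
apply: bounded_closed_compact closed_simplex.
exists 1; split => // M M1 t tS; rewrite /Num.norm /= mx_normrE.
apply: bigmax_le => [|[j i] _]; first by lra.
rewrite ord1 ger0_norm /=; first by apply: le_trans (ltW M1); exact: simplex_le1.
by case: tS.
Qed.

Definition grid_point N (a : grid 'I_n N) : 'rV[R]_n :=
  \row_i ((grid_coord a i)%:R / N%:R).

Lemma grid_point_simplex N (a : grid 'I_n N) : (0 < N)%N -> simplex (grid_point a).
Proof.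
move=> N0; split => [i|]; first by rewrite mxE divr_ge0.
under eq_bigr do rewrite mxE.
by rewrite -mulr_suml -natr_sum sum_grid_coord divff // pnatr_eq0 -lt0n.
Qed.
End Simplex.

Arguments simplex {R n}.

Section ClosedCover.
Variables (R : realType) (n : nat) (F : 'I_n.+1 -> set 'rV[R]_n.+1).
Hypothesis F_cover : forall t, simplex t -> exists i, F i t.

Lemma cover_simplex_near (eps : R) : 0 < eps -> exists2 x, simplex x &
  forall i, eps < x ord0 i -> F i `&` ball x eps !=set0.
Proof.
move=> eps0; pose N := (Num.bound (n.+1%:R / eps)).+1.
have N0 : (0 : R) < N%:R by rewrite ltr0n.
have NE : n.+1%:R / N%:R < eps.
  rewrite ltr_pdivrMr // mulrC -ltr_pdivrMr //.
  apply: lt_le_trans (archi_boundP _) _; first by rewrite divr_ge0 // ltW.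
  by rewrite ler_nat.
have lt_eps (a b : nat) : (a <= b + n.+1)%N -> a%:R / N%:R - b%:R / N%:R < eps.
  move=> ab; apply: le_lt_trans NE; rewrite -mulrBl ler_pM2r ?invr_gt0 //.
  by rewrite lerBlDl -natrD ler_nat.
have /choice[lab labP] (a : grid 'I_n.+1 N) : exists i, F i (grid_point R a).
  exact/F_cover/grid_point_simplex.
have [C [p [/set0Pn[j jC] pl pd pb]]] := small_cell ord0 lab.
rewrite card_ord in pd pb.
exists (grid_point R (p j)); first exact: grid_point_simplex.
move=> i; rewrite mxE => ei.
have iC : i \in C.
  apply: contraTT ei => iC; rewrite -leNgt; apply: ltW.
  by have := lt_eps _ 0%N (pb j i jC iC); rewrite mul0r subr0.
exists (grid_point R (p i)); split; first by have := labP (p i); rewrite pl.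
split=> // k0 k; rewrite /ball /= !mxE ltr_norml ltrNl opprB.
by rewrite !lt_eps ?pd.
Qed.

Hypothesis F_closed : forall i, closed (F i).

(* A KKM-type theorem with no condition on the boundary: instead of a common
   point of all the [F i], one finds a point in [F i] for each [i] in its support. *)
Theorem closed_cover_simplex : exists2 t, simplex t & forall i, 0 < t ord0 i -> F i t.
Proof.
have eps_gt0 (N : nat) : (0 : R) < N.+1%:R^-1 by rewrite invr_gt0 ltr0n.
have /choice[x xP] (N : nat) : exists x, simplex x /\
    forall i, N.+1%:R^-1 < x ord0 i -> F i `&` ball x N.+1%:R^-1 !=set0.
  by have [x xS xF] := cover_simplex_near (eps_gt0 N); exists x.
have [t [tS tcl]] : simplex `&` cluster (x @ \oo) !=set0.
  by apply: compact_simplex; exists 0%N => // N _; case: (xP N).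
exists t => // i ti; apply: F_closed => B /nbhs_ballP[e /= e0 eB].
pose d := Num.min e (t ord0 i) / 2.
have d0 : 0 < d by rewrite divr_gt0 // lt_min e0.
have dd : d + d = Num.min e (t ord0 i) by rewrite -splitr.
have [N0 _ N0P] := near_infty_natSinv_lt (PosNum d0).
have [||_ [[N NN0 <-] tx]] := tcl [set x N | N in [set N | (N0 <= N)%N]] (ball t d).
- by exists N0 => // N NN0; exists N.
- exact: nbhsx_ballx.
have Nd : N.+1%:R^-1 < d := N0P N NN0.
have [|y [Fy xy]] := (xP N).2 i.
  apply: lt_trans Nd _; have [_ /(_ ord0 i)] := tx.
  rewrite /ball /= ltr_norml => /andP[_].
  have : d + d <= t ord0 i by rewrite dd ge_min lexx orbT.
  lra.
exists y; split=> //; apply: eB.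
have de : d + d <= e by rewrite dd ge_min lexx.
by apply: le_ball de _ _; apply: ball_triangle tx _; apply: le_ball (ltW Nd) _ xy.
Qed.
End ClosedCover.

(** * Convex combinations and m-quasiconvex functions *)

Lemma convex_setP (R : realDomainType) (X : lmodType R) (C : set X) :
  convex_set (C : set (convex_lmodType X)) <->
  forall x y (a : R), 0 <= a -> a <= 1 -> C x -> C y -> C (a *: x + (1 - a) *: y).
Proof.
split=> [convC x y a a0 a1 Cx Cy|convC x y a]; last first.
  by rewrite !inE => Cx Cy; apply: convC.
have a01 : Itv.spec (@Itv.num_sem R) (Itv.Real `[0%Z, 1%Z]) a.
  by rewrite /= /Itv.num_sem /= in_itv /= a0 a1 ger0_real.
by have := convC x y (Itv.mk a01); rewrite !inE; exact.
Qed.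

Lemma convex_set_sum (R : realFieldType) (X : lmodType R) (C : set X)
    (I : finType) (t : I -> R) (y : I -> X) :
  convex_set (C : set (convex_lmodType X)) ->
  (forall i, 0 <= t i) -> \sum_i t i = 1 -> (forall i, 0 < t i -> C (y i)) ->
  C (\sum_i t i *: y i).
Proof.
move=> /convex_setP convC t0 t1 Cy.
have [x0 Cx0] : exists x, C x.
  apply: contrapT => noC; move: t1; rewrite big1 => [/eqP|i _].
    by rewrite eq_sym oner_eq0.
  apply/eqP; rewrite eq_le t0 leNgt andbT; apply/negP => /Cy Cyi.
  by apply: noC; exists (y i).
(* By induction, as the cone over [C] is closed under sums. *)
suff [_ [x Cx ->]] : 0 <= \sum_i t i /\
    exists2 x, C x & \sum_i t i *: y i = (\sum_i t i) *: x by rewrite t1 scale1r.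
elim/big_ind2: _ => [|_ a _ b [a0 [x Cx ->]] [b0 [z Cz ->]]|i _].
- by split=> //; exists x0; rewrite ?scale0r.
- split; first exact: addr_ge0.
  have [ab0|ab0] := eqVneq (a + b) 0.
    move/eqP: ab0; rewrite paddr_eq0 // => /andP[/eqP-> /eqP->].
    by exists x => //; rewrite addr0 !scale0r addr0.
  have ab_gt0 : 0 < a + b by rewrite lt_neqAle eq_sym ab0 addr_ge0.
  exists (a / (a + b) *: x + (1 - a / (a + b)) *: z).
    by apply: convC; rewrite ?divr_ge0 ?addr_ge0 // ler_pdivrMr // mul1r lerDl.
  by rewrite scalerDr !scalerA; congr (_ *: _ + _ *: _); field.
- split=> //; have := t0 i; rewrite le_eqVlt => /predU1P[<-|/Cy Cyi].
    by exists x0; rewrite ?scale0r.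
  by exists (y i).
Qed.

Section MQuasiconvex.
Variables (R : realType) (X : lmodType R).
Implicit Types u v : X -> R.

Lemma m_quasiconvex_max u v : m_quasiconvex u -> m_quasiconvex v ->
  m_quasiconvex (fun x => Num.max (u x) (v x)).
Proof.
move=> [u0 [uz uq]] [v0 [vz vq]]; split; first by move=> x; rewrite le_max u0.
split=> [|x y a a0 a1]; first by rewrite uz vz maxxx.
rewrite ge_max; apply/andP; split.
  by apply: le_trans (uq x y a a0 a1) _; rewrite ge_max !le_max !lexx /= !orbT.
by apply: le_trans (vq x y a a0 a1) _; rewrite ge_max !le_max !lexx /= !orbT.
Qed.

Lemma m_quasiconvex_bigmax (I : Type) (s : seq I) (u : I -> X -> R) :
  (forall i, m_quasiconvex (u i)) ->
  m_quasiconvex (fun x => \big[Num.max/0]_(i <- s) u i x).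
Proof.
move=> mqu; elim: s => [|i s IH].
  under eq_fun do rewrite big_nil.
  by do !split => // *; rewrite maxxx.
under eq_fun do rewrite big_cons.
exact: m_quasiconvex_max.
Qed.

Lemma m_quasiconvex_sum u (I : finType) (t : I -> R) (y : I -> X) (b : R) :
  m_quasiconvex u -> (forall i, 0 <= t i) -> \sum_i t i = 1 ->
  (forall i, 0 < t i -> u (y i) <= b) -> u (\sum_i t i *: y i) <= b.
Proof.
move=> [_ [_ uq]]; apply: (@convex_set_sum _ _ [set x | u x <= b]).
apply/convex_setP => x z a a0 a1 /= ux uz.
by apply: le_trans (uq _ _ _ a0 a1) _; rewrite ge_max ux.
Qed.
End MQuasiconvex.

(** * Compactness and continuity *)

Section Compactness.
Variables (T : topologicalType) (A : set T).
Hypothesis compA : compact A.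

Lemma compact_nbhs_subcover (U : T -> set T) :
  A !=set0 -> (forall x, A x -> nbhs x (U x)) ->
  exists n (y : 'I_n.+1 -> T), (forall i, A (y i)) /\
    forall x, A x -> exists i, U (y i) x.
Proof.
move=> A0 nbhsU; have [x0 _] := A0.
pose pT : ptopologicalType := HB.pack T (isPointed.Build T x0).
have : cover_compact (A : set pT) by rewrite -compact_cover.
move=> /(_ _ A (fun x => (U x)°))[x _||D DA AD]; first exact: open_interior.
  by move=> x Ax; exists x => //; exact: nbhsU.
pose s : seq T := D.
have [n size_s] : exists n, size s = n.+1.
  have [x /AD[z zD _]] := A0; have : z \in s by [].
  by case: s => // w s' _; exists (size s').
exists n, (fun i => nth x0 s i); split=> [i|x /AD[z zD /interior_subset Uz]].
  have s_i : nth x0 s i \in s by rewrite mem_nth ?size_s.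
  by have := DA _ s_i; rewrite inE.
have zn : (index z s < n.+1)%N by rewrite -size_s index_mem.
by exists (Ordinal zn); rewrite /= nth_index.
Qed.

Lemma compact_closed_bigcap (L : choiceType) (F : L -> set T) :
  (forall i, closed (F i : set (subspace A))) ->
  (forall s : seq L, exists2 x, A x & {in s, forall i, F i x}) ->
  exists2 x, A x & forall i, F i x.
Proof.
move=> closedF finF; have [x0 Ax0 _] := finF [::].
have [[i0]|noI] := pselect (inhabited L); last by exists x0 => // i; case: noI.
pose pT : ptopologicalType := HB.pack T (isPointed.Build T x0).
have : compact (A : set pT) := compA.
rewrite compact_In0 => /(_ _ setT (fun i => A `&` F i))[].
- have /choice[V VP] i : exists V, closed V /\ V `&` A = F i `&` A.
    by have /closed_subspaceP[V clV VF] := closedF i; exists V.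
  exists V => i _; first by case: (VP i).
  by rewrite setIC -(VP i).2 setIC.
- move=> D _; have [x Ax Fx] := finF D.
  by exists x => i /= iD; split=> //; exact: Fx.
- by move=> x AF; exists x => [|i]; [have [] := AF i0 I|have [] := AF i I].
Qed.
End Compactness.

Lemma within_continuous_comp_within (T U V : topologicalType) (A : set T) (B : set U)
    (g : T -> U) (f : U -> V) :
  (forall x, A x -> B (g x)) -> {within A, continuous g} ->
  {within B, continuous f} -> {within A, continuous (f \o g)}.
Proof.
move=> gAB /subspace_continuousP contg /subspace_continuousP contf.
apply/subspace_continuousP => x Ax W /(contf _ (gAB x Ax)) /(contg x Ax).
by apply: (@filterS _ (nbhs x)) => y /= Wfgy Ay; apply: Wfgy => //; exact: gAB.
Qed.

Lemma continuous_sub (T : topologicalType) (X : topologicalZmodType) (f g : T -> X) :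
  continuous f -> continuous g -> continuous (fun x => f x - g x).
Proof.
move=> contf contg x.
apply: (@continuous_comp T (X * X)%type X (fun x => (f x, g x)) (fun z => z.1 - z.2)).
  by apply: cvg_pair; [exact: contf|exact: contg].
exact: sub_continuous.
Qed.

Lemma continuous_lincomb (R : realType) (X : topologicalLmodType R) n (y : 'I_n -> X) :
  continuous (fun t : 'rV[R]_n => \sum_i t ord0 i *: y i).
Proof.
apply: continuous_big => [|i _]; first exact: add_continuous.
move=> t; apply: (@continuous_comp _ (R^o * X)%type _
  (fun t : 'rV[R]_n => (t ord0 i : R^o, y i)) (fun z => z.1 *: z.2)).
  apply: (@cvg_pair _ _ _ (nbhs t) (nbhs (t ord0 i : R^o)) (nbhs (y i))).
    exact: coord_continuous.
  exact: cvg_cst.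
exact: scale_continuous.
Qed.

(** * Fixed points *)

Section ConvexDomain.
Variables (R : realType) (X : topologicalLmodType R) (C : set X).
Hypothesis convC : convex_set (C : set (convex_lmodType X)).

Lemma convex_closed_cover n (Y : topologicalType) (f : X -> Y) (y : 'I_n.+1 -> X)
    (B : 'I_n.+1 -> set Y) :
  {within C, continuous f} -> (forall i, C (y i)) -> (forall i, closed (B i)) ->
  (forall x, C x -> exists i, B i (f x)) ->
  exists2 t, simplex t & forall i, 0 < t ord0 i -> B i (f (\sum_i t ord0 i *: y i)).
Proof.
move=> contf Cy closedB cover.
pose g (t : 'rV[R]_n.+1) := \sum_i t ord0 i *: y i.
have gC t : simplex t -> C (g t) by move=> [t0 t1]; exact: convex_set_sum.
have contfg : {within simplex, continuous (f \o g)}.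
  apply: within_continuous_comp_within gC _ contf.
  exact/continuous_subspaceT/continuous_lincomb.
have [t tS|i|t tS tF] :=
    @closed_cover_simplex R n (fun i => simplex `&` (f \o g) @^-1` B i).
- by have [i Bi] := cover _ (gC t tS); exists i.
- rewrite closed_setSI; last exact: closed_simplex.
  by apply: preimage_closed => // t _; exact: contfg.
- by exists t => // i /tF[].
Qed.

Hypotheses (C0 : C !=set0) (compC : compact C).
Variable f : X -> X.
Hypotheses (contf : {within C, continuous f}) (fC : f @` C `<=` C).

Lemma within_continuous_displacement (u : X -> R) :
  continuous u -> {within C, continuous (fun x => u (f x - x))}.
Proof.
move=> contu; apply: (@within_continuous_comp _ _ _ C (fun x => f x - x) u).
  by move=> x _; exact: contu.
apply: (@continuous_sub (subspace C) X) => //.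
by apply: (@continuous_subspaceT _ _ _ id) => x; exact: cvg_id.
Qed.

Lemma exists_small_displacement (u : X -> R) (eps : R) :
  continuous u -> m_quasiconvex u -> 0 < eps -> exists2 x, C x & u (f x - x) <= eps.
Proof.
move=> contu mqu eps0; have [_ [u0 _]] := mqu.
have contuB y : continuous (fun z => u (z - y)).
  move=> z; apply: (@continuous_comp _ _ _ (fun z => z - y) u); last exact: contu.
  by apply: continuous_sub => w; [exact: cvg_id|exact: cvg_cst].
have [//|x _|n [y [Cy yC]]] :=
    compact_nbhs_subcover compC (U := fun y => [set z | u (z - y) < eps]).
  apply: (contuB x x [set r | r < eps]); apply: lt_nbhsl.
  by rewrite subrr u0.
have [i|x Cx|t [t0 t1] tB] := @convex_closed_cover n _ f y
    (fun i => [set z | u (z - y i) <= eps]) contf Cy.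
- apply: (@preimage_closed _ _ (fun z => u (z - y i)) [set r | r <= eps]).
    by move=> z _; exact: contuB.
  exact: closed_le.
- have [i yi] : exists i, u (f x - y i) < eps by apply: yC; apply: fC; exists x.
  by exists i; exact: ltW.
exists (\sum_i t ord0 i *: y i); first exact: convex_set_sum.
set z := f _ in tB *.
have -> : z - \sum_i t ord0 i *: y i = \sum_i t ord0 i *: (z - y i).
  under [RHS]eq_bigr do rewrite scalerBr.
  by rewrite sumrB -scaler_suml t1 scale1r.
exact: m_quasiconvex_sum.
Qed.

Lemma exists_zero_displacement (u : X -> R) :
  continuous u -> m_quasiconvex u -> exists2 x, C x & u (f x - x) = 0.
Proof.
move=> contu mqu; have [u_ge0 _] := mqu.
have [x] := compact_EVT_min C0 compC (within_continuous_displacement contu).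
rewrite inE => Cx xmin; exists x => //; apply/eqP; rewrite eq_le u_ge0 andbT.
apply/ler_addgt0Pr => eps eps0; rewrite add0r.
have [z Cz zeps] := exists_small_displacement contu mqu eps0.
by apply: le_trans zeps; apply: xmin; rewrite inE.
Qed.
End ConvexDomain.

Theorem theorem4p1 (R : realType) (X : topologicalLmodType R) :
  hausdorff_space X -> quasi_point_separable X -> fixed_point_property X.
Proof.
move=> _ [L [u [contu [mqu sep]]]] C C0 compC convC f contf fC.
have [l|s|x Cx ux] := @compact_closed_bigcap X C compC {classic L}
    (fun l => [set x | u l (f x - x) = 0]).
- apply: (@preimage_closed (subspace C) R (fun x => u l (f x - x)) [set 0]).
    by move=> x _; exact: within_continuous_displacement.
  exact: closed_eq.
- pose v x := \big[Num.max/0]_(l <- s) u l x.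
  have [||x Cx vx] := @exists_zero_displacement R X C convC C0 compC f contf fC v.
  + apply: continuous_big => [z|l _ //].
    by apply: (@continuous_max _ _ fst snd); [exact: cvg_fst|exact: cvg_snd].
  + exact: m_quasiconvex_bigmax.
  exists x => // l ls; apply/eqP; rewrite eq_le (mqu l).1 andbT -vx.
  exact: (@le_bigmax_seq _ _ _ _ _ l predT (fun l => u l (f x - x))).
- by exists x => //; apply/eqP; rewrite -subr_eq0; apply/eqP/sep.
Qed.
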